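(* Let $A\in\mathbb{C}^{n\times n}$ be Hermitian, let $X^{(0)}\in\mathbb{C}^{n\times m_0}$, and let $V\in\mathbb{C}^{n\times m_0k}$ be a basis of the block Krylov subspace $\mathcal{K}(A,X^{(0)})=\mathrm{span}\{X^{(0)},AX^{(0)},\dots,A^{k-1}X^{(0)}\}$. The Krylov subspace generated by $zI-A$ and $X^{(0)}$ depends only on $A$ and not on the shift $z$, so that the basis $V$ is not a function of $z$. Let $\mathcal{C}$ be a closed contour in the complex plane, and suppose that for $z\in\mathcal{C}$ a Krylov subspace method is used to find an approximate solution $$Y(z)=VY_V(z),\qquad Y_V(z)\in\mathbb{C}^{m_0k\times m_0},$$ of the linear system $(zI-A)Y(z)=X^{(0)}$. Then the subspace matrix $Q=\frac{1}{2\pi i}\oint_{\mathcal{C}}Y(z)\,dz$ is $$Q=VG_v,\qquad G_v=\frac{1}{2\pi i}\oint_{\mathcal{C}}Y_V(z)\,dz\in\mathbb{C}^{m_0k\times m_0},$$ and the FEAST reduced eigenvalue problem $(Q^HAQ)X_Q=(Q^HQ)X_Q\Lambda$ becomes $$(G_v^HV^HAVG_v)X_Q=(G_v^HV^HVG_v)X_Q\Lambda .$$ Comparing this with the reduced problem $(V^HAV)X_V=(V^HV)X_V\Lambda$ of a traditional block Krylov method shows that IFEAST is itself a Krylov subspace method. The difference from traditional Krylov methods is that IFEAST uses contour integration to select a linear combination of vectors from the Krylov basis $V$ for finding the desired eigenvalues, without first having to solve a reduced eigenvalue problem in that basis.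
   Context: The superscript $H$ denotes conjugate transpose, and the span of a list of matrices means the span of all their columns. A traditional block Krylov eigenvalue method builds the basis $V$ and applies the Rayleigh–Ritz procedure in it, i.e. solves $(V^HAV)X_V=(V^HV)X_V\Lambda$ with $\Lambda$ a diagonal matrix of approximate eigenvalues. FEAST with exact contour integration forms $Q=\frac{1}{2\pi i}\oint_{\mathcal{C}}(zI-A)^{-1}X^{(0)}dz=\frac{1}{2\pi i}\oint_{\mathcal{C}}Y(z)\,dz$, where $(zI-A)Y(z)=X^{(0)}$ and $\mathcal{C}$ encloses the wanted eigenvalues, and then solves the reduced problem $(Q^HAQ)X_Q=(Q^HQ)X_Q\Lambda$. IFEAST is FEAST with the linear systems solved approximately by an iterative method, here a Krylov subspace method. *)

(* Defs.v *)
From HB Require Import structures.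
From mathcomp Require Import all_boot all_order all_algebra.
From mathcomp Require Import all_classical all_reals all_analysis.
From mathcomp Require Import complex.

Set Implicit Arguments.
Unset Strict Implicit.
Unset Printing Implicit Defensive.

Import Order.TTheory GRing.Theory Num.Theory.
Import numFieldNormedType.Exports.

Local Open Scope classical_set_scope.
Local Open Scope ring_scope.
Local Open Scope complex_scope.
Local Open Scope sesquilinear_scope.

Definition columns (F : fieldType) (n m : nat) (M : 'M[F]_(n, m)) :
    seq 'cV[F]_n :=
  [seq col j M | j <- enum 'I_m].

Definition span_of_matrices (F : fieldType) (n m : nat)
    (Ms : seq 'M[F]_(n, m)) : {vspace 'cV[F]_n} :=
  <<flatten [seq columns M | M <- Ms]>>%VS.

Definition block_krylov (F : fieldType) (n m k : nat)
    (A : 'M[F]_n) (X : 'M[F]_(n, m)) : {vspace 'cV[F]_n} :=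
  span_of_matrices [seq A ^+ j *m X | j <- iota 0 k].

(* The Rayleigh-Ritz reduced problem
     (W^H A W) X = (W^H W) X Lambda,  Lambda = diag(lam),
   for an arbitrary trial matrix W.  Both methods solve this problem: the
   traditional block Krylov method with W = V, FEAST with W = Q. *)
Definition reduced_problem (R : realType) (n p q : nat) (A : 'M[R[i]]_n)
    (W : 'M[R[i]]_(n, p)) (X : 'M[R[i]]_(p, q)) (lam : 'rV[R[i]]_q) : Prop :=
  (W ^t* *m A *m W) *m X = (W ^t* *m W) *m X *m diag_mx lam.

(* C^1 on a compact interval is expressed by agreement with a function that is
   C^1 on the whole line. *)
Definition piecewise_C1 (R : realType) (a b : R) (f : R -> R) : Prop :=
  exists2 s : seq R, itv_partition a b s &
    forall i : nat, (i < size s)%N ->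
      exists g : R -> R,
        [/\ forall t : R, derivable g t 1,
            continuous (derive1 g) &
            forall t : R, nth b (a :: s) i <= t <= nth b s i -> f t = g t].

Record closed_contour (R : realType) := ClosedContour {
  contour_path :> R -> R[i];
  contour_start : R;
  contour_end : R;
  contour_lt : contour_start < contour_end;
  contour_C1_Re :
    piecewise_C1 contour_start contour_end (fun t => complex.Re (contour_path t));
  contour_C1_Im :
    piecewise_C1 contour_start contour_end (fun t => complex.Im (contour_path t));
  contour_closed : contour_path contour_start = contour_path contour_end
}.

Definition on_contour (R : realType) (C : closed_contour R) (z : R[i]) : Prop :=
  exists2 t : R, contour_start C <= t <= contour_end C & C t = z.

Definition velocity (R : realType) (C : closed_contour R) (t : R) : R[i] :=
  derive1 (fun s => complex.Re (C s)) t +i*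
  derive1 (fun s => complex.Im (C s)) t.

Definition pullback (R : realType) (C : closed_contour R) (f : R[i] -> R[i])
    (t : R) : R[i] :=
  f (C t) * velocity C t.

Definition contour_integrable (R : realType) (C : closed_contour R)
    (f : R[i] -> R[i]) : Prop :=
  (@lebesgue_measure R).-integrable `[contour_start C, contour_end C]
      (fun t => (complex.Re (pullback C f t))%:E) /\
  (@lebesgue_measure R).-integrable `[contour_start C, contour_end C]
      (fun t => (complex.Im (pullback C f t))%:E).

Definition contour_integral (R : realType) (C : closed_contour R)
    (f : R[i] -> R[i]) : R[i] :=
  Rintegral (@lebesgue_measure R) `[contour_start C, contour_end C]
      (fun t => complex.Re (pullback C f t)) +i*
  Rintegral (@lebesgue_measure R) `[contour_start C, contour_end C]
      (fun t => complex.Im (pullback C f t)).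

Definition mx_contour_integrable (R : realType) (n m : nat)
    (C : closed_contour R) (F : R[i] -> 'M[R[i]]_(n, m)) : Prop :=
  forall i j, contour_integrable C (fun z => F z i j).

(* (1 / (2 pi i)) \oint_C F(z) dz, entrywise; [0 +i* (2 * pi)] is 2 pi i. *)
Definition normalized_contour_integral (R : realType) (n m : nat)
    (C : closed_contour R) (F : R[i] -> 'M[R[i]]_(n, m)) : 'M[R[i]]_(n, m) :=
  ((0 : R) +i* (2 * pi))^-1 *:
    \matrix_(i, j) contour_integral C (fun z => F z i j).

(* Main.v *)
Require Import Defs.
From HB Require Import structures.
From mathcomp Require Import all_boot all_order all_algebra.
From mathcomp Require Import all_classical all_reals all_analysis.
From mathcomp Require Import complex.

Import Order.TTheory GRing.Theory Num.Theory.
Local Open Scope ring_scope.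
Local Open Scope complex_scope.
Local Open Scope sesquilinear_scope.

Set Implicit Arguments.
Unset Strict Implicit.

(** Two facts drive the result.  First, every power of [z%:M - A] up to the
[j]-th lies in the span of the powers of [A] up to the [j]-th, and conversely,
so the block Krylov subspace does not see the shift [z]
([block_krylov_shift]) and a single basis [V] serves for all [z].

Second, [V] does not depend on [z], so it comes out of the contour integral of
[Y z = V *m YV z] ([normalized_contour_integral_mulmx]), which gives
[Q = V *m Gv]; the reduced problem for [Q] and the inclusion of its column space
in the Krylov subspace follow by matrix algebra.  Integrability is known for
[Y] only.  It carries over to [YV] because the columns of [V] are free: [V] has
a left inverse [L] ([free_columns_linv]), and [YV z = L *m Y z] along the
contour, whatever factorization [YV] is given.  The same [L] yields the
existence of a factorization, [V *m (L *m Y z) = Y z] ([linv_mulmxK]). *)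

(** * Column spans *)

Lemma mem_columns (F : fieldType) (n m : nat) (M : 'M[F]_(n, m)) (j : 'I_m) :
  col j M \in columns M.
Proof. by apply: map_f; rewrite mem_enum. Qed.

Lemma span_columnsP (F : fieldType) (n m : nat) (M : 'M[F]_(n, m))
    (v : 'cV[F]_n) :
  reflect (exists c : 'cV[F]_m, v = M *m c) (v \in <<columns M>>%VS).
Proof.
have mulE (c : 'I_m -> F) :
    M *m (\col_j c j) = \sum_(j < m) c j *: col j M.
  apply/matrixP => i l; rewrite mxE summxE.
  by apply: eq_bigr => j _; rewrite !mxE mulrC.
apply: (iffP idP) => [vM | [c ->]]; last first.
  have -> : c = \col_j c j 0 by apply/matrixP => i l; rewrite mxE (ord1 l).
  rewrite mulE; apply: memv_suml => j _.
  by apply/memvZ/memv_span/mem_columns.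
exists (\col_j coord [tuple col j M | j < m] j v).
rewrite mulE [LHS](coord_span (X := [tuple col j M | j < m]) vM).
by apply: eq_bigr => j _; rewrite nth_mktuple.
Qed.

Lemma span_columns_mulmx (F : fieldType) (n m p : nat) (M : 'M[F]_(n, m))
    (B : 'M[F]_(m, p)) :
  (<<columns (M *m B)>> <= <<columns M>>)%VS.
Proof.
apply/span_subvP => _ /mapP[j _ ->].
by apply/span_columnsP; exists (col j B); rewrite !colE mulmxA.
Qed.

(** The rows of the left inverse are the coordinate functionals of the family of
columns, evaluated on the canonical basis.  Freeness is what makes the
coordinates of the columns themselves a Kronecker delta. *)
Lemma free_columns_linv (F : fieldType) (n m : nat) (M : 'M[F]_(n, m)) :
  free (columns M) -> exists L : 'M[F]_(m, n), L *m M = 1%:M.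
Proof.
move=> freeM; exists (\matrix_(i, j) coord [tuple col j M | j < m] i (delta_mx j 0)).
have coordE (i : 'I_m) (v : 'cV[F]_n) :
    coord [tuple col j M | j < m] i v =
    \sum_j coord [tuple col j M | j < m] i (delta_mx j 0) * v j 0.
  rewrite [in LHS](matrix_sum_delta v) linear_sum.
  by apply: eq_bigr => j _; rewrite big_ord1 linearZ mulrC.
apply/matrixP => i j; rewrite !mxE.
transitivity (coord [tuple col j M | j < m] i (col j M)).
  by rewrite coordE; apply: eq_bigr => l _; rewrite !mxE.
rewrite -[col j M](nth_mktuple (fun j => col j M) 0) coord_free //.
by rewrite eq_sym.
Qed.

(** Although [M *m L] is in general not the identity, it acts as the identity on
the column space of [M]; so [L *m N] is a matrix of coordinates of [N] that
depends linearly on [N], which is how integrability passes from [N] to its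
coordinates. *)
Lemma linv_mulmxK (F : fieldType) (n m p : nat) (M : 'M[F]_(n, m))
    (L : 'M[F]_(m, n)) (N : 'M[F]_(n, p)) :
  L *m M = 1%:M -> (<<columns N>> <= <<columns M>>)%VS -> M *m (L *m N) = N.
Proof.
move=> LM /span_subvP NM; apply/matrixP => i j.
have /span_columnsP[c Nc] := NM _ (mem_columns N j).
have NE (B : 'M[F]_(n, p)) l : B l j = col j B l 0 by rewrite mxE.
by rewrite !NE !colE -!mulmxA -colE Nc [L *m _]mulmxA LM mul1mx.
Qed.

(** * Shift invariance of Krylov subspaces *)

Lemma mem_block_krylov (F : fieldType) (n m k j : nat) (A : 'M[F]_n)
    (X : 'M[F]_(n, m)) (l : 'I_m) :
  (j < k)%N -> col l (A ^+ j *m X) \in block_krylov k A X.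
Proof.
move=> jk; apply/memv_span/flattenP; exists (columns (A ^+ j *m X)).
  by apply/map_f/map_f; rewrite mem_iota.
exact: mem_columns.
Qed.

Lemma block_krylov_subv (F : fieldType) (n m k : nat) (A : 'M[F]_n)
    (X : 'M[F]_(n, m)) (U : {vspace 'cV[F]_n}) :
  (forall j l, (j < k)%N -> col l (A ^+ j *m X) \in U) ->
  (block_krylov k A X <= U)%VS.
Proof.
move=> AU; apply/span_subvP => v /flattenP[_ /mapP[_ /mapP[j jk ->] ->]].
by move: jk; rewrite mem_iota => jk /mapP[l _ ->]; apply: AU.
Qed.

(** The binomial expansion in its only relevant aspect: a power of a shift of [A]
is a polynomial in [A] of no larger degree. *)
Lemma shift_expr (F : fieldType) (n : nat) (A : 'M[F]_n) (z : F) (j : nat) :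
  exists c : nat -> F,
    (z%:M - A) ^+ j = \sum_(i < j.+1) c i *: A ^+ i.
Proof.
elim: j => [|j [c IH]].
  by exists (fun=> 1); rewrite big_ord1 !expr0 scale1r.
(* The coefficients of [z%:M * S - A * S], for [S] the expansion of the
   previous power: multiplying by [A] moves every coefficient up by one. *)
exists (fun i => (if (i <= j)%N then z * c i else 0)
                  - (if i is i'.+1 then c i' else 0)).
rewrite exprS IH mulrBl.
rewrite (eq_bigr _ (fun i _ => scalerBl _ _ _)) sumrB; congr (_ - _).
  rewrite [RHS]big_ord_recr /= ltnn scale0r addr0 -[LHS]/(z%:M *m _).
  rewrite mul_scalar_mx scaler_sumr.
  by apply: eq_bigr => i _; rewrite -ltnS ltn_ord scalerA.
rewrite [RHS]big_ord_recl /= scale0r add0r mulr_sumr.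
by apply: eq_bigr => i _; rewrite exprS -[LHS]/(A *m _) -scalemxAr.
Qed.

Lemma block_krylov_shift_subv (F : fieldType) (n m k : nat) (A : 'M[F]_n)
    (X : 'M[F]_(n, m)) (z : F) :
  (block_krylov k (z%:M - A) X <= block_krylov k A X)%VS.
Proof.
apply: block_krylov_subv => j l jk.
have [c ->] := shift_expr A z j.
rewrite mulmx_suml linear_sum; apply: memv_suml => i _.
rewrite -scalemxAl linearZ; apply/memvZ/mem_block_krylov.
exact: leq_trans (ltn_ord i) jk.
Qed.

(** The inclusion holds for every matrix, so it yields its converse: [A] is in turn the shift
[z%:M - (z%:M - A)] of [z%:M - A]. *)
Lemma block_krylov_shift (F : fieldType) (n m k : nat) (A : 'M[F]_n)
    (X : 'M[F]_(n, m)) (z : F) :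
  block_krylov k (z%:M - A) X = block_krylov k A X.
Proof.
apply/eqP; rewrite eqEsubv block_krylov_shift_subv /=.
by rewrite -{1}[A](subKr z%:M) block_krylov_shift_subv.
Qed.

(** * Linearity of the contour integral *)

Lemma ReM (R : realType) (a w : R[i]) :
  complex.Re (a * w) = complex.Re a * complex.Re w - complex.Im a * complex.Im w.
Proof. by case: a w => [? ?] [? ?]. Qed.

Lemma ImM (R : realType) (a w : R[i]) :
  complex.Im (a * w) = complex.Im a * complex.Re w + complex.Re a * complex.Im w.
Proof. by case: a w => [? ?] [? ?]; rewrite addrC. Qed.

(** Real and imaginary parts of a product by a complex constant are real
combinations of this shape, which reduces complex linearity to real
linearity. *)
Lemma Rintegral_comb (R : realType) (D : set R) (f g : R -> R) (a b : R) :
  measurable D ->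
  (@lebesgue_measure R).-integrable D (EFin \o f) ->
  (@lebesgue_measure R).-integrable D (EFin \o g) ->
  (@lebesgue_measure R).-integrable D (EFin \o (fun t => a * f t + b * g t)) /\
  Rintegral (@lebesgue_measure R) D (fun t => a * f t + b * g t) =
    a * Rintegral (@lebesgue_measure R) D f +
    b * Rintegral (@lebesgue_measure R) D g.
Proof.
move=> mD fint gint.
have fZ : (@lebesgue_measure R).-integrable D (EFin \o (fun t => a * f t)).
  by apply: (eq_integrable _ _ _ _ (integrableZl _ a fint)).
have gZ : (@lebesgue_measure R).-integrable D (EFin \o (fun t => b * g t)).
  by apply: (eq_integrable _ _ _ _ (integrableZl _ b gint)).
split; first by apply: (eq_integrable _ _ _ _ (integrableD _ fZ gZ)).
by rewrite RintegralD // !RintegralZl.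
Qed.

Section ContourIntegral.
Context (R : realType) (C : closed_contour R).
Implicit Types (f g : R[i] -> R[i]) (a : R[i]).

(** The integrals see an integrand only along the contour; the values of an
approximate solution elsewhere are arbitrary. *)
Lemma eq_pullback f g :
  (forall z, on_contour C z -> f z = g z) ->
  {in `[contour_start C, contour_end C]%classic,
    pullback C f =1 pullback C g}.
Proof.
move=> fg t; rewrite inE /= in_itv /= => tC.
by rewrite /pullback fg //; exists t.
Qed.

Lemma eq_contour_integrable f g :
  (forall z, on_contour C z -> f z = g z) ->
  contour_integrable C f -> contour_integrable C g.
Proof.
move=> /eq_pullback fg [fRe fIm]; split.
  by apply: eq_integrable fRe => // t tC; rewrite fg.
by apply: eq_integrable fIm => // t tC; rewrite fg.
Qed.

Lemma eq_contour_integral f g :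
  (forall z, on_contour C z -> f z = g z) ->
  contour_integral C f = contour_integral C g.
Proof.
move=> /eq_pullback fg; rewrite /contour_integral.
by congr (_ +i* _); apply: eq_Rintegral => t tC; rewrite fg.
Qed.

Lemma contour_integral0 :
  contour_integrable C (fun=> 0) /\ contour_integral C (fun=> 0) = 0.
Proof.
have p0 : pullback C (fun=> 0) = fun=> 0.
  by apply/funext => t; rewrite /pullback mul0r.
rewrite /contour_integral /contour_integrable p0; split.
  by split; apply: integrable0.
by congr (_ +i* _); rewrite /Rintegral integral0.
Qed.

Lemma contour_integralD f g :
  contour_integrable C f -> contour_integrable C g ->
  contour_integrable C (fun z => f z + g z) /\
  contour_integral C (fun z => f z + g z) =
    contour_integral C f + contour_integral C g.
Proof.
move=> [fRe fIm] [gRe gIm].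
have ReE : (fun t => complex.Re (pullback C (fun z => f z + g z) t)) =
    (fun t => 1 * complex.Re (pullback C f t) + 1 * complex.Re (pullback C g t)).
  by apply/funext => t; rewrite /pullback mulrDl !mul1r raddfD.
have ImE : (fun t => complex.Im (pullback C (fun z => f z + g z) t)) =
    (fun t => 1 * complex.Im (pullback C f t) + 1 * complex.Im (pullback C g t)).
  by apply/funext => t; rewrite /pullback mulrDl !mul1r raddfD.
split.
  split; [move/(congr1 (fun h => EFin \o h)): ReE
         |move/(congr1 (fun h => EFin \o h)): ImE];
    by rewrite /comp /= => ->; apply: (Rintegral_comb _ _ _ _ _).1.
by rewrite /contour_integral ReE ImE !(Rintegral_comb _ _ _ _ _).2 // !mul1r.
Qed.

Lemma contour_integralZ a f :
  contour_integrable C f ->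
  contour_integrable C (fun z => a * f z) /\
  contour_integral C (fun z => a * f z) = a * contour_integral C f.
Proof.
move=> [fRe fIm].
have ReE : (fun t => complex.Re (pullback C (fun z => a * f z) t)) =
    (fun t => complex.Re a * complex.Re (pullback C f t)
              + - complex.Im a * complex.Im (pullback C f t)).
  by apply/funext => t; rewrite /pullback -mulrA ReM mulNr.
have ImE : (fun t => complex.Im (pullback C (fun z => a * f z) t)) =
    (fun t => complex.Im a * complex.Re (pullback C f t)
              + complex.Re a * complex.Im (pullback C f t)).
  by apply/funext => t; rewrite /pullback -mulrA ImM.
split.
  split; [move/(congr1 (fun h => EFin \o h)): ReE
         |move/(congr1 (fun h => EFin \o h)): ImE];
    by rewrite /comp /= => ->; apply: (Rintegral_comb _ _ _ _ _).1.
rewrite /contour_integral ReE ImE !(Rintegral_comb _ _ _ _ _).2 //.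
by apply/eqP; rewrite eq_complex ReM ImM mulNr /= !eqxx.
Qed.

Lemma contour_integral_sum (p : nat) (a : 'I_p -> R[i])
    (f : 'I_p -> R[i] -> R[i]) :
  (forall j, contour_integrable C (f j)) ->
  contour_integrable C (fun z => \sum_j a j * f j z) /\
  contour_integral C (fun z => \sum_j a j * f j z) =
    \sum_j a j * contour_integral C (f j).
Proof.
move=> fint; elim: (index_enum _) => [|j s [IHint IHE]].
  by under eq_fun do rewrite big_nil; rewrite big_nil; apply: contour_integral0.
under eq_fun do rewrite big_cons.
have [Zint ZE] := contour_integralZ (a j) (fint j).
have [Dint DE] := contour_integralD Zint IHint.
by rewrite big_cons DE ZE IHE.
Qed.

(** A constant matrix on the left moves out of the integral, since each entry of
the product is a fixed linear combination of entries of the integrand. *)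
Lemma normalized_contour_integral_mulmx (n p m : nat) (M : 'M[R[i]]_(n, p))
    (F : R[i] -> 'M[R[i]]_(p, m)) :
  mx_contour_integrable C F ->
  mx_contour_integrable C (fun z => M *m F z) /\
  normalized_contour_integral C (fun z => M *m F z) =
    M *m normalized_contour_integral C F.
Proof.
move=> Fint.
have sumP i j := contour_integral_sum (M i) (Fint^~ j).
have mulE i j : (fun z => (M *m F z) i j) = (fun z => \sum_l M i l * F z l j).
  by apply/funext => z; rewrite mxE.
split=> [i j|]; first by rewrite mulE; have [] := sumP i j.
rewrite /normalized_contour_integral -scalemxAr; congr (_ *: _).
apply/matrixP => i j; rewrite !mxE mulE; have [_ ->] := sumP i j.
by apply: eq_bigr => l _; rewrite mxE.
Qed.

Lemma eq_mx_contour_integrable (n m : nat) (F G : R[i] -> 'M[R[i]]_(n, m)) :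
  (forall z, on_contour C z -> F z = G z) ->
  mx_contour_integrable C F -> mx_contour_integrable C G.
Proof.
move=> FG Fint i j; apply: eq_contour_integrable (Fint i j) => z zC.
by rewrite FG.
Qed.

Lemma eq_normalized_contour_integral (n m : nat)
    (F G : R[i] -> 'M[R[i]]_(n, m)) :
  (forall z, on_contour C z -> F z = G z) ->
  normalized_contour_integral C F = normalized_contour_integral C G.
Proof.
move=> FG; congr (_ *: _); apply/matrixP => i j; rewrite !mxE.
by apply: eq_contour_integral => z zC; rewrite FG.
Qed.

End ContourIntegral.

(** * The subspace matrix as a selection from the Krylov basis *)

Unset Implicit Arguments.
Set Strict Implicit.

Theorem mainTheorem2 (R : realType) (n m0 k : nat)
    (A : 'M[R[i]]_n) (hA : A \is hermsymmx)
    (X0 : 'M[R[i]]_(n, m0))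
    (V : 'M[R[i]]_(n, m0 * k))
    (hV : basis_of (block_krylov k A X0) (columns V))
    (C : closed_contour R)
    (Y : R[i] -> 'M[R[i]]_(n, m0))
    (hY : forall z : R[i], on_contour C z ->
      (<<columns (Y z)>> <= block_krylov k (z%:M - A) X0)%VS)
    (hYint : mx_contour_integrable C Y) :
  [/\ forall z : R[i],
        block_krylov k (z%:M - A) X0 = block_krylov k A X0 /\
        basis_of (block_krylov k (z%:M - A) X0) (columns V),
      exists YV : R[i] -> 'M[R[i]]_(m0 * k, m0),
        forall z : R[i], on_contour C z -> Y z = V *m YV z
    & forall YV : R[i] -> 'M[R[i]]_(m0 * k, m0),
        (forall z : R[i], on_contour C z -> Y z = V *m YV z) ->
        let Q := normalized_contour_integral C Y in
        let Gv := normalized_contour_integral C YV in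
        [/\ mx_contour_integrable C YV,
            Q = V *m Gv /\
            (forall i : 'I_m0,
               col i Q = \sum_(j < m0 * k) Gv j i *: col j V),
            forall (q : nat) (XQ : 'M[R[i]]_(m0, q)) (lam : 'rV[R[i]]_q),
              reduced_problem A Q XQ lam <->
              (Gv ^t* *m (V ^t* *m A *m V) *m Gv) *m XQ =
                (Gv ^t* *m (V ^t* *m V) *m Gv) *m XQ *m diag_mx lam,
            (<<columns Q>> <= block_krylov k A X0)%VS
          & forall (q : nat) (XQ : 'M[R[i]]_(m0, q)) (lam : 'rV[R[i]]_q),
              reduced_problem A Q XQ lam ->
              (<<columns (Q *m XQ)>> <= block_krylov k A X0)%VS]].
Proof.
have [/eqP spanV freeV] := andP hV.
have [L LV] := free_columns_linv freeV.
split=> [z||YV YVE Q Gv].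
- by rewrite block_krylov_shift.
- exists (fun z => L *m Y z) => z zC.
  rewrite linv_mulmxK // spanV -(block_krylov_shift _ _ _ z).
  exact: hY.
have LYint : mx_contour_integrable C YV.
  have [LYint _] := normalized_contour_integral_mulmx L hYint.
  apply: eq_mx_contour_integrable LYint => z zC.
  by rewrite YVE // mulmxA LV mul1mx.
have QE : Q = V *m Gv.
  have [_ <-] := normalized_contour_integral_mulmx V LYint.
  exact: eq_normalized_contour_integral.
have Qsub : (<<columns Q>> <= block_krylov k A X0)%VS.
  by rewrite QE -spanV span_columns_mulmx.
split=> //.
- split=> // i; rewrite QE; apply/matrixP => l o.
  rewrite !mxE summxE; apply: eq_bigr => j _.
  by rewrite !mxE mulrC.
- move=> q XQ lam; rewrite /reduced_problem QE.
  by rewrite trmx_mul map_mxM !mulmxA.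
- move=> q XQ lam _; apply: subv_trans Qsub.
  exact: span_columns_mulmx.
Qed.
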